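(* Let $G$ be a graph on $n$ vertices, let $k\ge 2$, and let $m_1,m_2,\dots,m_k>0$ be integers. Then $$\operatorname{depth}_E W(G,m_1,\dots,m_k)=n(m_1+1)(m_2+1)\cdots(m_{k-2}+1)\,m_k,$$ where the product $(m_1+1)\cdots(m_{k-2}+1)$ is $1$ when $k=2$. In particular, for any integers $m>0$ and $k\ge 2$, $$\operatorname{depth}_E W^k(G,m)=nm(m+1)^{k-2}.$$
   Context: Let $\mathbf{k}$ be an algebraically closed field of characteristic zero. Graphs are finite and simple. For a graph $G$ and an integer $m>0$, $W(G,m)$ denotes the graph formed by attaching $m$ new degree-one vertices to each vertex of $G$. For integers $m_1,\dots,m_k>0$, define recursively $W(G,m_1,\dots,m_k)=W(W(G,m_1,\dots,m_{k-1}),m_k)$; when $m_i=m$ for all $i$, this graph is denoted $W^k(G,m)$. For a graph $H$ with vertices $v_1,\dots,v_N$, let $E=\bigwedge_{\mathbf k}\langle e_1,\dots,e_N\rangle$ be the exterior algebra over $\mathbf{k}$ in $N$ variables, with degree-one part $E_1$, and let $I_E(H)=(e_ie_j \mid \{v_i,v_j\}\text{ is an edge of }H)\subseteq E$. For a graded $E$-module $M$, an element $\ell\in E_1$ is $M$-regular if $\{y\in M\mid \ell y=0\}=\ell M$. A sequence $\ell_1,\dots,\ell_r\in E_1$ is an $M$-regular sequence if $\ell_i$ is regular on $M/(\ell_1,\dots,\ell_{i-1})M$ for all $i\le r$; $\operatorname{depth}_E M$ is the maximum length of an $M$-regular sequence. Write $\operatorname{depth}_E H=\operatorname{depth}_E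 E/I_E(H)$, where $E$ is the exterior algebra on the vertices of $H$. *)

(* Defs.v *)
From HB Require Import structures.
From mathcomp Require Import all_boot all_order all_algebra.
From mathcomp Require Import boolp.

Set Implicit Arguments.
Unset Strict Implicit.
Unset Printing Implicit Defensive.

Import GRing.Theory.
Local Open Scope ring_scope.
Local Open Scope quotient_scope.

Record sgraph := SGraph {
  vertex :> finType;
  edge : rel vertex;
  edge_sym : symmetric edge;
  edge_irr : irreflexive edge }.

(* The vertices of W(G,m) are those of G (inl v) together with, for each
   vertex v of G, m new vertices inr (v, j) adjacent to v only. *)
Section Whisker.
Variables (G : sgraph) (m : nat).

Definition whisker_edge : rel (G + G * 'I_m)%type := fun x y =>
  match x, y with
  | inl u, inl v => edge u v
  | inl u, inr (v, _) => u == v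
  | inr (u, _), inl v => u == v
  | inr _, inr _ => false
  end.

Lemma whisker_edge_sym : symmetric whisker_edge.
Proof. by move=> [u|[u i]] [v|[v j]] //=; first exact: edge_sym. Qed.

Lemma whisker_edge_irr : irreflexive whisker_edge.
Proof. by move=> [u|[u i]] //=; rewrite edge_irr. Qed.

Definition whisker := SGraph whisker_edge_sym whisker_edge_irr.

End Whisker.

(* W(G, m 1, ..., m k); the sequence is indexed from 1. *)
Fixpoint whiskers (G : sgraph) (m : nat -> nat) (k : nat) : sgraph :=
  if k is k'.+1 then whisker (whiskers G m k') (m k) else G.

(* W^k(G,m) *)
Definition whisker_iter (G : sgraph) (m k : nat) : sgraph :=
  whiskers G (fun=> m) k.

(* The exterior algebra on the basis (e_v), v in V: x : ext K V is the family
   of its coordinates on the basis e_A = e_{a_1} ... e_{a_r}, for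
   A = {a_1 < ... < a_r} a subset of V ordered by enum_rank. Hence
   e_A * e_B = 0 if A and B meet, and e_A * e_B = (-1)^s e_(A U B)
   otherwise, where s = inversions A B counts the pairs (a, b) in A x B with b < a. *)
Definition ext (K : fieldType) (V : finType) := {ffun {set V} -> K^o}.

Section ExteriorAlgebra.
Variables (K : fieldType) (V : finType).
Local Notation E := (ext K V).

HB.instance Definition _ := Vector.copy E {ffun {set V} -> K^o}.

Implicit Types (A B C D : {set V}) (x y z : E).

Definition inversions A B : nat :=
  (\sum_(a in A) \sum_(b in B) (enum_rank b < enum_rank a))%N.

Definition ext_mul x y : E :=
  [ffun C : {set V} => \sum_(A : {set V} | A \subset C)
     (-1) ^+ inversions A (C :\: A) * x A * y (C :\: A) : K^o].

Definition ext_one : E := [ffun A : {set V} => (A == set0)%:R : K^o].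

Definition ext_var (v : V) : E :=
  [ffun A : {set V} => (A == [set v])%:R : K^o].

Lemma inversions0l B : inversions set0 B = 0%N.
Proof. by rewrite /inversions big_set0. Qed.

Lemma inversions0r A : inversions A set0 = 0%N.
Proof. by rewrite /inversions big1 // => a _; rewrite big_set0. Qed.

Lemma inversionsUl A B C : [disjoint A & B] ->
  inversions (A :|: B) C = (inversions A C + inversions B C)%N.
Proof.
move=> dAB; rewrite /inversions -bigU //.
by apply: eq_bigl => a; rewrite !inE.
Qed.

Lemma inversionsUr A B C : [disjoint B & C] ->
  inversions A (B :|: C) = (inversions A B + inversions A C)%N.
Proof.
move=> dBC; rewrite /inversions -big_split /=.
apply: eq_bigr => a _; rewrite -bigU //.
by apply: eq_bigl => b; rewrite !inE.
Qed.

Lemma ext_mulE x y C : ext_mul x y C = \sum_(A : {set V} | A \subset C)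
  (-1) ^+ inversions A (C :\: A) * x A * y (C :\: A).
Proof. by rewrite ffunE. Qed.

Lemma ext_mulA : associative ext_mul.
Proof.
move=> x y z; apply/ffunP => C; rewrite !ext_mulE.
pose F A D : K := (-1) ^+ inversions D (C :\: D) *
  ((-1) ^+ inversions A (D :\: A) * x A * y (D :\: A)) * z (C :\: D).
transitivity (\sum_(A : {set V} | A \subset C)
    \sum_(D : {set V} | (A \subset D) && (D \subset C)) F A D); last first.
  rewrite (exchange_big_dep (fun D : {set V} => D \subset C)) /=; last first.
    by move=> A D _ /andP[].
  apply: eq_bigr => D sDC; rewrite ext_mulE mulr_sumr mulr_suml.
  apply: eq_bigl => A; apply/andP/idP=> [[_ /andP[]] //|sAD].
  by rewrite (subset_trans sAD sDC) sAD.
apply: eq_bigr => A sAC; rewrite ext_mulE mulr_sumr.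
rewrite (reindex_onto (fun D => D :\: A) (fun B => A :|: B)) /=; last first.
  move=> B; rewrite subsetD => /andP[_ dBA].
  by rewrite setDUl setDv set0U; apply/setDidPl.
apply: eq_big => [D|D /andP[sD /eqP eD]].
  apply/andP/andP=> [[sD /eqP eD]|[sAD sDC]].
    split; first by rewrite -eD subsetUl.
    by rewrite -eD subUset sAC (subset_trans sD) ?subsetDl.
  split; first exact: setSD.
  by apply/eqP; rewrite -{1}(setIidPr sAD) setID.
have sAD : A \subset D by rewrite -eD subsetUl.
have sDC : D \subset C.
  by rewrite -eD subUset sAC (subset_trans sD) ?subsetDl.
have -> : C :\: A :\: (D :\: A) = C :\: D.
  apply/setP => v; rewrite !inE; have := subsetP sAD v.
  by case: (v \in A) => [->|]; rewrite ?andbT.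
have CE : C :\: A = (D :\: A) :|: (C :\: D).
  apply/setP => v; rewrite !inE; have := subsetP sAD v; have := subsetP sDC v.
  by case: (v \in A); case: (v \in D); case: (v \in C) => // h1 h2;
    first [by have := h1 isT | by have := h2 isT].
have DE : inversions D (C :\: D) =
    (inversions A (C :\: D) + inversions (D :\: A) (C :\: D))%N.
  rewrite -{1}eD inversionsUl //.
  by rewrite disjoint_sym disjoints_subset subsetDr.
have dis : [disjoint D :\: A & C :\: D].
  rewrite disjoint_sym disjoints_subset; apply/subsetP=> v.
  by rewrite !inE => /andP[/negPf-> _]; rewrite andbF.
rewrite /F {1}CE inversionsUr // DE !exprD.
have shuffle (a b c p q r : K) :
    a * b * p * (c * q * r) = b * c * (a * p * q) * r.
  rewrite -!mulrA [LHS]mulrCA; congr (_ * _).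
  by rewrite [RHS]mulrCA; congr (_ * _); rewrite [LHS]mulrCA.
exact: shuffle.
Qed.

Lemma ext_mul1l : left_id ext_one ext_mul.
Proof.
move=> x; apply/ffunP => C; rewrite ext_mulE (bigD1 set0) ?sub0set //=.
rewrite big1 => [|A /andP[_ /negPf A0]]; last first.
  by rewrite ffunE A0 mulr0 mul0r.
by rewrite setD0 inversions0l ffunE eqxx !mul1r addr0.
Qed.

Lemma ext_mul1r : right_id ext_one ext_mul.
Proof.
move=> x; apply/ffunP => C; rewrite ext_mulE (bigD1 C) //=.
rewrite big1 => [|A /andP[sAC nAC]]; last first.
  rewrite ffunE setD_eq0; have [sCA|_] := boolP (C \subset A).
    by rewrite eqEsubset sAC sCA in nAC.
  by rewrite mulr0.
by rewrite setDv inversions0r ffunE eqxx mulr1 mul1r addr0.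
Qed.

Lemma ext_mulDl : left_distributive ext_mul +%R.
Proof.
move=> x y z; apply/ffunP => C; rewrite [RHS]ffunE !ext_mulE -big_split /=.
by apply: eq_bigr => A _; rewrite ffunE mulrDr mulrDl.
Qed.

Lemma ext_mulDr : right_distributive ext_mul +%R.
Proof.
move=> x y z; apply/ffunP => C; rewrite [RHS]ffunE !ext_mulE -big_split /=.
by apply: eq_bigr => A _; rewrite ffunE mulrDr.
Qed.

Lemma ext_one_neq0 : ext_one != 0.
Proof. by apply/eqP => /ffunP/(_ set0)/eqP; rewrite !ffunE eqxx oner_eq0. Qed.

HB.instance Definition _ := GRing.Zmodule_isNzRing.Build E
  ext_mulA ext_mul1l ext_mul1r ext_mulDl ext_mulDr ext_one_neq0.

Lemma ext_scaleAl (a : K) x y : a *: (x * y) = (a *: x) * y.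
Proof.
apply/ffunP => C; rewrite [LHS]ffunE !ext_mulE scaler_sumr.
by apply: eq_bigr => A _; rewrite [in RHS]ffunE scalerAl /= scalerAr.
Qed.

Lemma ext_scaleAr (a : K) x y : a *: (x * y) = x * (a *: y).
Proof.
apply/ffunP => C; rewrite [LHS]ffunE !ext_mulE scaler_sumr.
by apply: eq_bigr => A _; rewrite [in RHS]ffunE scalerAr.
Qed.

HB.instance Definition _ := GRing.Lmodule_isLalgebra.Build K E ext_scaleAl.
HB.instance Definition _ := GRing.Lalgebra_isAlgebra.Build K E ext_scaleAr.

(* The degree-one part E_1. *)
Definition ext1 : {vspace E} := <<[seq ext_var v | v : V]>>%VS.

End ExteriorAlgebra.

Section Modules.
Variable R : nzRingType.

Record submodule (M : lmodType R) := Submodule {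
  submodule_pred :> {pred M};
  submoduleP : submod_closed submodule_pred }.

HB.instance Definition _ (M : lmodType R) (N : submodule M) :=
  GRing.isSubmodClosed.Build R M (submodule_pred N) (submoduleP N).

Section Span.
Variables (M : lmodType R) (S : M -> Prop).

Definition submod_span_pred : {pred M} := fun x =>
  `[< forall N : submodule M, (forall y, S y -> y \in N) -> x \in N >].

Lemma submod_span_closed : submod_closed submod_span_pred.
Proof.
split=> [|a x y /asboolP hx /asboolP hy]; apply/asboolP => N sN.
  exact: rpred0.
by apply: rpredD; [apply: rpredZ; apply: hx | apply: hy].
Qed.

Definition submod_span : submodule M := Submodule submod_span_closed.

End Span.

(* The two-sided ideal generated by S: the left ideal generated by the right
   multiples of the elements of S. *)
Definition ideal_span (S : R -> Prop) : submodule R^o :=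
  submod_span (M := R^o) (fun x => exists s a : R, S s /\ x = s * a).

(* The submodule I M, for an ideal I of R. *)
Definition ideal_mul (I : submodule R^o) (M : lmodType R) : submodule M :=
  submod_span (fun x : M => exists (a : R) (y : M), a \in I /\ x = a *: y).

(* The quotient module M / N: the quotient group of the library, with the
   induced scaling. *)
Section QuotientModule.
Variables (M : lmodType R) (N : submodule M).

Definition quotmod := Quotient.quot (submodule_pred N : zmodClosed M).
HB.instance Definition _ := GRing.Zmodule.on quotmod.
HB.instance Definition _ :
    ZmodQuotient M (Quotient.equiv (submodule_pred N : zmodClosed M))
      0 -%R +%R quotmod :=
  ZmodQuotient.on quotmod.
Local Notation Q := quotmod.

Definition quot_scale (a : R) (x : Q) : Q :=
  \pi_Q (a *: repr x).

Lemma quot_pi_scale (a : R) (x : M) :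
  quot_scale a (\pi_Q x) = \pi_Q (a *: x).
Proof.
apply/eqP; rewrite -Quotient.idealrBE -scalerBr rpredZ //.
by rewrite Quotient.idealrBE reprK.
Qed.

Lemma quot_scaleA (a b : R) (x : Q) :
  quot_scale a (quot_scale b x) = quot_scale (a * b) x.
Proof. by rewrite -[x]reprK !quot_pi_scale scalerA reprK. Qed.

Lemma quot_scale1 : left_id 1 quot_scale.
Proof. by move=> x; rewrite -[x]reprK quot_pi_scale scale1r. Qed.

Lemma quot_scaleDr : right_distributive quot_scale +%R.
Proof.
move=> a x y; rewrite -[x]reprK -[y]reprK -raddfD !quot_pi_scale.
by rewrite scalerDr raddfD.
Qed.

Lemma quot_scaleDl (x : Q) : {morph quot_scale^~ x : a b / a + b}.
Proof. by move=> a b; rewrite -[x]reprK !quot_pi_scale scalerDl raddfD. Qed.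

HB.instance Definition _ := GRing.Zmodule_isLmodule.Build R Q
  quot_scaleA quot_scale1 quot_scaleDr quot_scaleDl.

End QuotientModule.

End Modules.

Section Depth.
Variables (K : fieldType) (V : finType).
Local Notation E := (ext K V).
Implicit Types (M : lmodType E) (l : E) (s : seq E).

(* { y in M | l y = 0 } = l M *)
Definition regular M l : Prop :=
  forall y : M, l *: y = 0 <-> exists z : M, y = l *: z.

Definition regular_seq M s : Prop :=
  {subset s <= ext1 K V} /\
  forall i, (i < size s)%N ->
    regular (quotmod (ideal_mul (ideal_span (fun l => l \in take i s)) M))
      s`_i.

(* depth_E M = d *)
Definition has_depth M (d : nat) : Prop :=
  (exists2 s, regular_seq M s & size s = d) /\
  (forall s, regular_seq M s -> (size s <= d)%N).

End Depth.

Definition edge_ideal (K : fieldType) (H : sgraph) :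
    submodule (ext K H)^o :=
  ideal_span (fun x =>
    exists u v : H, edge u v /\ x = ext_var K u * ext_var K v).

(* depth_E H = d *)
Definition graph_has_depth (K : fieldType) (H : sgraph) (d : nat) : Prop :=
  has_depth (quotmod (edge_ideal K H)) d.

(* Main.v *)
From HB Require Import structures.
Require Import Defs.
From mathcomp Require Import all_boot all_order all_algebra.
From mathcomp Require Import boolp zify.

Set Implicit Arguments.
Unset Strict Implicit.
Unset Printing Implicit Defensive.

Import GRing.Theory.
Local Open Scope ring_scope.
Local Open Scope quotient_scope.

(** Put [H = W(W(G, a), b)] with [a, b > 0], let [I] be its edge ideal and
    [M = E / I]. Each vertex [x] of [G] (a core vertex) carries [b] leaves, and
    is joined to [a] stars, each with its own center and [b] leaves. The theorem
    reduces to the equality of [depth M] and [#|G| * b]: take for [G] the graph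
    obtained after the first [k - 2] attachments, which has
    [n (m_1 + 1) ... (m_(k-2) + 1)] vertices.

    Regularity is a matter of dimension. If [l] is a linear form and [U] an
    ideal, then [l^2 = 0] gives [dim (E / U) <= 2 dim (E / (U + (l)))], with
    equality exactly when [l] is regular modulo [U] ([codim_regular]). Hence [s]
    is a regular sequence on [E / I] iff [2 ^ size s * dim (E / (I + (s)))] is at
    most [dim (E / I)] ([codim_regular_seq], [regular_seqE]). This criterion only
    involves the ideal generated by [s], so that an element of [s] can be
    exchanged for a linear combination of [s] in which it occurs, and every
    combination of [s] with a nonzero coefficient is regular on [E / I]
    ([regular_seq_comb]).

    Depth at most [#|G| * b]. A longer regular sequence has a nontrivial
    combination [l] whose coefficients on the [#|G| * b] core leaves all vanish.
    No such [l] is regular ([nonregular]). Let [F] consist of all core leaves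
    and, in each star, of the center if [l] has a nonzero coefficient on some
    leaf of the star and of the leaves otherwise. Then [l e_F] lies in [I], as
    [F] is a maximal independent set, and [e_F] does not lie in [I + (l)],
    because there is a product [w] of linear forms with [w l = 0], [w I = 0] and
    [w e_F <> 0] ([edge_obstruction]).

    Depth at least [#|G| * b]. Choose one star at each core vertex and add to the
    [j]-th leaf of the core vertex the [j]-th leaf of that star. These sums
    form a regular sequence: modulo them, each leaf of a pair is the opposite of
    the other one, so [E / (I + (s))] is spanned by the monomials of the
    independent sets which, for each pair, avoid the star leaf if the core
    vertex is present and the core leaf if it is absent ([leaf_pairs_span]). In
    any independent set these leaves can be added or removed freely, so there
    are at least [2 ^ (#|G| * b)] times as many independent sets as sets of
    this kind ([card_reduced_indep]), and [dim (E / I)] is at least the number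
    of independent sets ([card_indep_codim]). *)

(** * Calculus in the exterior algebra *)

Section ExteriorCalculus.
Variables (K : fieldType) (V : finType).
Local Notation E := (ext K V).
Local Notation e := (ext_var K).
Local Notation E1 := (ext1 K V).
Implicit Types (A B C : {set V}) (x y z l : E) (u v : V) (s : seq E).

Definition ext_mono A : E := [ffun B : {set V} => (B == A)%:R : K^o].

(** The grading involution, which makes linear forms commute with everything up
    to a twist: [x l = l (grade_sign x)]. Left and right multiples of a linear
    form are thus the same, in every characteristic. *)
Definition grade_sign x : E := [ffun A : {set V} => (-1) ^+ #|A| * x A : K^o].

Lemma ext_mono_sum x : x = \sum_A x A *: ext_mono A.
Proof.
apply/ffunP => C; rewrite sum_ffunE (bigD1 C) //= big1 => [|A nAC].
  by rewrite !ffunE eqxx /GRing.scale /= mulr1 addr0.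
by rewrite !ffunE eq_sym (negPf nAC) /GRing.scale /= mulr0.
Qed.

Lemma ext_var_mulE v x C : (e v * x) C =
  if v \in C then (-1) ^+ inversions [set v] (C :\ v) * x (C :\ v) else 0.
Proof.
rewrite [LHS]ext_mulE; case: ifP => [vC|/negbT nvC].
  rewrite (bigD1 [set v]) ?sub1set //= big1 => [|A /andP[_ /negPf nA]].
    by rewrite addr0 ffunE eqxx mulr1.
  by rewrite ffunE nA mulr0 mul0r.
rewrite big1 // => A sAC; rewrite ffunE; case: eqP => [eA|_].
  by rewrite eA sub1set (negPf nvC) in sAC.
by rewrite mulr0 mul0r.
Qed.

Lemma ext_mul_varE x v C : (x * e v) C =
  if v \in C then (-1) ^+ inversions (C :\ v) [set v] * x (C :\ v) else 0.
Proof.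
rewrite [LHS]ext_mulE; case: ifP => [vC|/negbT nvC].
  rewrite (bigD1 (C :\ v)) ?subsetDl //= big1 => [|A /andP[sAC nA]].
    by rewrite setDDr setDv set0U (setIidPr _) ?sub1set // addr0 ffunE eqxx mulr1.
  rewrite ffunE; case: eqP => [eA|_]; last by rewrite mulr0.
  by case/eqP: nA; rewrite -eA setDDr setDv set0U (setIidPr sAC).
rewrite big1 // => A sAC; rewrite ffunE; case: eqP => [eA|_].
  have : v \in C :\: A by rewrite eA set11.
  by rewrite !inE (negPf nvC) andbF.
by rewrite mulr0.
Qed.

Lemma inversions_swap v C : v \notin C ->
  (inversions [set v] C + inversions C [set v])%N = #|C|.
Proof.
move=> vC; rewrite /inversions big_set1 -[RHS]sum1_card -big_split /=.
apply: eq_bigr => u uC; pose lt_u (w : V) : nat := (enum_rank w < enum_rank u)%N.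
rewrite (big_set1 addn v lt_u) /lt_u.
have : (enum_rank u : nat) != enum_rank v.
  by apply: contraNneq vC => /val_inj/enum_rank_inj <-.
by case: ltngtP.
Qed.

Lemma mulr_sign_inv (a b c : nat) : (a + b)%N = c ->
  (-1) ^+ a = (-1) ^+ b * (-1) ^+ c :> K.
Proof.
by move=> <-; rewrite addnC exprD mulrA -expr2 -exprM mulnC exprM sqrrN expr1n
  expr1n mul1r.
Qed.

Lemma ext_mul_varC x v : x * e v = e v * grade_sign x.
Proof.
apply/ffunP => C; rewrite ext_mul_varE ext_var_mulE; case: ifP => // vC.
rewrite ffunE mulrA -(@mulr_sign_inv (inversions (C :\ v) [set v])) //.
by rewrite addnC inversions_swap // !inE eqxx.
Qed.

Lemma ext_var_sqr v : e v * e v = 0.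
Proof.
apply/ffunP => C; rewrite ext_var_mulE !ffunE; case: ifP => // _.
by case: eqP => [eC|_]; rewrite ?mulr0 //; have := set11 v; rewrite -eC !inE eqxx.
Qed.

Lemma grade_sign_var v : grade_sign (e v) = - e v.
Proof.
apply/ffunP => C; rewrite !ffunE; case: eqP => [->|_]; last by rewrite mulr0 oppr0.
by rewrite cards1 expr1 mulN1r.
Qed.

Lemma ext_var_anti u v : e u * e v = - (e v * e u).
Proof. by rewrite ext_mul_varC grade_sign_var mulrN. Qed.

Lemma ext_var_mono v A : v \notin A ->
  e v * ext_mono A = (-1) ^+ inversions [set v] A *: ext_mono (v |: A).
Proof.
move=> nvA; apply/ffunP => C; rewrite ext_var_mulE !ffunE.
have [vC|nvC] := boolP (v \in C).
  have -> : (C :\ v == A) = (C == v |: A).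
    by apply/eqP/eqP => [<-|->]; rewrite ?setD1K ?setU1K.
  by case: eqP => [->|_]; rewrite ?setU1K /GRing.scale //= !mulr0.
case: eqP => [eC|_]; rewrite ?scaler0 //.
by rewrite eC setU11 in nvC.
Qed.

Lemma ext_mono_var u A : u \in A ->
  ext_mono A = (-1) ^+ inversions [set u] (A :\ u) *: (e u * ext_mono (A :\ u)).
Proof.
move=> uA; rewrite ext_var_mono ?setD11 // setD1K //.
by rewrite scalerA -expr2 sqrr_sign scale1r.
Qed.

Lemma ext_var_mono0 v A : v \in A -> e v * ext_mono A = 0.
Proof.
move=> vA; apply/ffunP => C; rewrite ext_var_mulE !ffunE; case: ifP => // _.
by case: eqP => [eC|_]; rewrite ?mulr0 //; rewrite -eC !inE eqxx in vA.
Qed.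

Lemma ext_var_in v : e v \in E1.
Proof. by apply/memv_span/imageP; exists v. Qed.

Definition linear_part x : E := \sum_v x [set v] *: e v.

Fact linear_part_linear : linear linear_part.
Proof.
move=> a x y; rewrite /linear_part scaler_sumr -big_split; apply: eq_bigr => v _.
by rewrite !ffunE scalerDl scalerA.
Qed.

HB.instance Definition _ :=
  GRing.isLinear.Build K E E *:%R linear_part linear_part_linear.

Lemma linear_part_var v : linear_part (e v) = e v.
Proof.
rewrite /linear_part (bigD1 v) //= big1 => [|u nuv].
  by rewrite ffunE eqxx scale1r addr0.
by rewrite ffunE (inj_eq set1_inj) (negPf nuv) scale0r.
Qed.

Lemma ext1_sum l : l \in E1 -> l = \sum_v l [set v] *: e v.
Proof.
rewrite -[RHS]/(linear_part l) /ext1 => lE.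
have [c ->] : exists c : 'I_#|V| -> K, l = \sum_i c i *: [seq e v | v : V]`_i.
  exists (fun i => coord (image_tuple (ext_var K (V:=V)) V) i l).
  exact: (coord_span lE).
rewrite linear_sum; apply: eq_bigr => i _.
rewrite linearZ /=; congr (_ *: _).
have : nth 0 [seq e v | v : V] i \in [seq e v | v : V].
  by rewrite mem_nth // size_image ltn_ord.
case/imageP=> v _ /= eX.
by rewrite [nth _ _ _]eX linear_part_var.
Qed.

Lemma ext1_mulC x l : l \in E1 -> x * l = l * grade_sign x.
Proof.
move=> /ext1_sum ->; rewrite mulr_sumr mulr_suml; apply: eq_bigr => v _.
by rewrite -scalerAr -scalerAl ext_mul_varC.
Qed.

Lemma ext1_var_anti l v : l \in E1 -> e v * l = - (l * e v).
Proof. by move=> lE; rewrite ext1_mulC // grade_sign_var mulrN. Qed.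

(** In characteristic 2 this does not follow from anticommutation, hence the
    induction on the support of [l]. *)
Lemma ext1_sqr l : l \in E1 -> l * l = 0.
Proof.
move=> lE1; rewrite (ext1_sum lE1).
elim: (index_enum V) => [|v r IH]; first by rewrite big_nil mul0r.
rewrite big_cons; set x := \sum_(j <- r) _ in IH *.
have xE : x \in E1.
  by apply: rpred_sum => u _; apply/rpredZ/ext_var_in.
rewrite mulrDl !mulrDr IH addr0 -!scalerAl -!scalerAr ext_var_sqr !scaler0 add0r.
by rewrite ext1_var_anti // scalerN addNr.
Qed.

(** The second occurrence of a repeated factor can be moved next to the first. *)
Lemma linear_form_prod_kill (r : seq V) (p : V -> E) u :
    (forall v, p v \in E1) -> u \in r -> (\prod_(v <- r) p v) * p u = 0.
Proof.
move=> pE; elim: r => //= v r IH; rewrite inE big_cons -mulrA => /predU1P[<-|/IH->].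
  by rewrite [X in _ * X]ext1_mulC // mulrA ext1_sqr ?mul0r.
by rewrite mulr0.
Qed.

End ExteriorCalculus.

(** * Regularity and dimension *)

Section RegularityDimension.
Variables (K : fieldType) (V : finType).
Local Notation E := (ext K V).
Local Notation E1 := (ext1 K V).
Implicit Types (U W : {vspace E}) (x y z l : E) (s : seq E).

Definition lmul l : 'End(E) := linfun (l \*o idfun).
Lemma lmulE l x : lmul l x = l * x.
Proof. by rewrite /lmul lfunE. Qed.

(** For a linear form [l] this is the two-sided ideal generated by [l]. *)
Definition rideal l : {vspace E} := limg (lmul l).

Lemma ridealP l x : reflect (exists z, x = l * z) (x \in rideal l).
Proof.
apply: (iffP memv_imgP) => [[z _ ->]|[z ->]]; exists z; rewrite ?lmulE //.
exact: memvf.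
Qed.

Definition left_closed (U : {vspace E}) := forall x y, y \in U -> x * y \in U.

(** Regularity of [l] on [E / U], without the inclusion that holds for every
    linear form. *)
Definition regular_mod (U : {vspace E}) l :=
  forall x, l * x \in U -> x \in (U + rideal l)%VS.

Definition codim (U : {vspace E}) := (dim E - \dim U)%N.

Lemma left_closedD (U W : {vspace E}) :
  left_closed U -> left_closed W -> left_closed (U + W).
Proof.
move=> hU hW x _ /memv_addP[y yU [z zW ->]].
by rewrite mulrDr memv_add ?hU ?hW.
Qed.

Lemma rideal_left_closed l : l \in E1 -> left_closed (rideal l).
Proof.
move=> lE x _ /ridealP[z ->]; apply/ridealP; exists (grade_sign x * z).
by rewrite !mulrA (ext1_mulC x lE).
Qed.

(** Multiplication by [l] induces an isomorphism from [E / (U : l)] to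
    [(U + l E) / U]. *)
Lemma codim_colon (U : {vspace E}) l :
  (codim (lmul l @^-1: U) + \dim U)%N = \dim (U + rideal l).
Proof.
have sk : (lker (lmul l) <= lmul l @^-1: U)%VS.
  by rewrite -lpreim0 lpreimS ?sub0v.
have := limg_ker_dim (lmul l) (lmul l @^-1: U).
rewrite (capv_idPr sk) -lpreim_cap_limg lpreimK ?capvSr // lpreim_cap_limg => eP.
have := limg_ker_dim (lmul l) fullv; rewrite capfv dimvf => eE.
have := dimv_sum_cap U (rideal l).
have := dimvS (capvSr U (rideal l)).
rewrite /codim -eP -eE /rideal subnDl /=.
move: (\dim (U + _)) (\dim (U :&: _)) (\dim U) (\dim (limg _)); lia.
Qed.

(** The ideal [U : l] contains [U + l E] since [l^2 = 0], and it is equal to it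
    iff [l] is regular; its codimension is given by [codim_colon]. *)
Lemma codim_regular (U : {vspace E}) l : l \in E1 -> left_closed U ->
  (codim U <= 2 * codim (U + rideal l))%N /\
  ((2 * codim (U + rideal l) <= codim U)%N <-> regular_mod U l).
Proof.
move=> lE hU; set W := (U + rideal l)%VS; set P := (lmul l @^-1: U)%VS.
have sWP : (W <= P)%VS.
  apply/subvP => _ /memv_addP[x xU [_ /ridealP[z ->] ->]].
  rewrite -memv_preim lmulE mulrDr memvD ?(hU _ x) //.
  by rewrite mulrA ext1_sqr // mul0r mem0v.
have [le_codim eq_codim] : (codim U <= 2 * codim W)%N /\
    ((2 * codim W <= codim U)%N <-> (\dim P <= \dim W)%N).
  move: (codim_colon U l) (dimvS (subvf P)) (dimvS (subvf W)) (dimvS sWP).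
  rewrite dimvf -/W -/P /codim.
  move: (\dim P) (\dim W) (\dim U) (dim _) => p w u n /=; lia.
split=> //; rewrite eq_codim; split=> [lePW x lx|reg].
  have /eqP eWP : W == P by rewrite -(dimv_leqif_eq sWP) eqn_leq lePW dimvS.
  by rewrite -/W eWP -memv_preim lmulE.
by apply/dimvS/subvP => x; rewrite -memv_preim lmulE; apply: reg.
Qed.

Definition add_rideals (U : {vspace E}) s := foldl (fun W l => (W + rideal l)%VS) U s.

Lemma add_rideals_left_closed (U : {vspace E}) s :
  {subset s <= E1} -> left_closed U -> left_closed (add_rideals U s).
Proof.
elim: s U => //= l s IH U sE hU; apply: IH => [x xs|].
  by apply: sE; rewrite inE xs orbT.
by apply: left_closedD hU _; apply: rideal_left_closed; apply: sE; rewrite inE eqxx.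
Qed.

(** The inequality of [codim_regular] is applied along the sequence; the product
    of these inequalities is an equality iff each of them is. *)
Lemma codim_regular_seq (U : {vspace E}) s : {subset s <= E1} -> left_closed U ->
  (codim U <= 2 ^ size s * codim (add_rideals U s))%N /\
  ((2 ^ size s * codim (add_rideals U s) <= codim U)%N <->
   forall i, (i < size s)%N -> regular_mod (add_rideals U (take i s)) s`_i).
Proof.
elim: s U => [|l s IH] U sE hU /=; first by rewrite mul1n; split.
have lE : l \in E1 by apply: sE; rewrite inE eqxx.
have sE' : {subset s <= E1} by move=> x xs; apply: sE; rewrite inE xs orbT.
have [h1 h2] := codim_regular lE hU.
have [h3 h4] := IH _ sE' (left_closedD hU (rideal_left_closed lE)).
rewrite expnS -mulnA; split; first lia.
split=> [h [|i] /= hi|h].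
- by apply/h2; lia.
- by apply/h4: i hi; lia.
- have /h2 h5 := h 0 isT.
  have /h4 h6 : forall i, (i < size s)%N ->
     regular_mod (add_rideals (U + rideal l) (take i s)) s`_i.
    by move=> i; apply: (h i.+1).
  lia.
Qed.

Lemma add_rideals_sub (U W : {vspace E}) s :
  reflect ((U <= W)%VS /\ forall l, l \in s -> (rideal l <= W)%VS)
    (add_rideals U s <= W)%VS.
Proof.
elim: s U => [|l s IH] U /=; first by apply: (iffP idP) => // -[].
apply: (iffP (IH _)); rewrite subv_add.
  move=> [/andP[hU hl] hs]; split=> // x; rewrite inE => /predU1P[->//|]; exact: hs.
move=> [hU hs]; split=> [|x xs]; rewrite ?hU ?hs ?inE ?eqxx ?xs ?orbT //.
Qed.

Lemma add_rideals_ind (P : E -> Prop) U s :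
    (forall x y, P x -> P y -> P (x + y)) ->
    (forall x, x \in U -> P x) -> (forall l z, l \in s -> P (l * z)) ->
  forall x, x \in add_rideals U s -> P x.
Proof.
move=> PD; elim: s U => [|l s IH] U PU Ps //=.
apply: IH => [_ /memv_addP[x xU [_ /ridealP[z ->] ->]]|l' z l's].
  by apply: PD; [apply: PU | apply: Ps; rewrite inE eqxx].
by apply: Ps; rewrite inE l's orbT.
Qed.

Lemma sub_add_rideals U s : (U <= add_rideals U s)%VS.
Proof. by have /add_rideals_sub[] := subvv (add_rideals U s). Qed.

Lemma add_rideals_mem U s l z : l \in s -> l * z \in add_rideals U s.
Proof.
have /add_rideals_sub[_ h] := subvv (add_rideals U s).
by move=> /h /subvP; apply; apply/ridealP; exists z.
Qed.

Lemma left_closed_submod U :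
  left_closed U -> submod_closed (fun x : E^o => (x : E) \in U).
Proof.
move=> hU; split=> [|a x y xU yU]; first exact: mem0v.
by rewrite memvD // hU.
Qed.

End RegularityDimension.


(** * Ideals and quotient modules *)

Section IdealSpan.
Variables (R : nzRingType) (S : R -> Prop).

Lemma ideal_span_min (N : submodule R^o) x :
    (forall l z : R, S l -> (l * z : R^o) \in N) ->
  x \in ideal_span S -> x \in N.
Proof. by move=> h /asboolP; apply => _ [l [z [Sl ->]]]; apply: h. Qed.

Lemma ideal_span_mem l z : S l -> (l * z : R^o) \in ideal_span S.
Proof. by move=> Sl; apply/asboolP => N; apply; exists l, z. Qed.

End IdealSpan.

Section QuotientMap.
Variables (R : nzRingType) (L : lmodType R) (N : submodule L).

Lemma pi_scale (a : R) (x : L) :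
  a *: (\pi_(quotmod N) x : quotmod N) = \pi_(quotmod N) (a *: x).
Proof. exact: quot_pi_scale. Qed.

Lemma pi_eq0 (x : L) :
  (\pi_(quotmod N) x == 0 :> quotmod N) = (x \in N).
Proof. by rewrite -[0 in LHS](raddf0 \pi_(quotmod N)) -Quotient.idealrBE subr0. Qed.

End QuotientMap.

(** * The quotient of the exterior algebra by an edge ideal *)

Section QuotientModules.
Variables (K : fieldType) (H : sgraph).
Local Notation E := (ext K H).
Local Notation e := (ext_var K).
Local Notation E1 := (ext1 K H).
Implicit Types (U W : {vspace E}) (x y z l : E) (s : seq E).

(** A product of two variables commutes with all elements up to a twist by the
    grading, so its right multiples already form a two-sided ideal. *)
Definition edge_idealv : {vspace E} :=
  (\sum_(p : H * H | edge p.1 p.2) rideal (e p.1 * e p.2))%VS.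

Lemma edge_idealv_mem u v x : edge u v -> e u * e v * x \in edge_idealv.
Proof.
move=> uv; apply: (subvP (sumv_sup (u, v) uv (subvv _))).
by apply/ridealP; exists x.
Qed.

Lemma edge_idealv_ind (P : E -> Prop) :
    P 0 -> (forall x y, P x -> P y -> P (x + y)) ->
    (forall u v x, edge u v -> P (e u * e v * x)) ->
  forall x, x \in edge_idealv -> P x.
Proof.
move=> P0 PD Pe _ /memv_sumP[f fE ->]; elim/big_ind: _ => // -[u v] uv.
by have /ridealP[z ->] := fE _ uv; apply: Pe.
Qed.

Lemma edge_idealv_left_closed : left_closed edge_idealv.
Proof.
move=> x y; elim/edge_idealv_ind: y / => [|y z hy hz|u v z uv].
- by rewrite mulr0 mem0v.
- by rewrite mulrDr memvD.
rewrite !mulrA (ext1_mulC x (ext_var_in _ u)) -(mulrA (e u)).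
rewrite (ext1_mulC _ (ext_var_in _ v)) mulrA -mulrA; exact: edge_idealv_mem.
Qed.

Lemma mem_edge_ideal x : ((x : E^o) \in edge_ideal K H) = (x \in edge_idealv).
Proof.
apply/idP/idP.
  apply: (@ideal_span_min _ _ (Submodule (left_closed_submod edge_idealv_left_closed))).
  by move=> _ z [u [v [uv ->]]]; apply: edge_idealv_mem.
elim/edge_idealv_ind: x / => [|x y hx hy|u v z uv]; first exact: rpred0.
  exact: rpredD.
by apply: ideal_span_mem; exists u, v.
Qed.

Local Notation M := (quotmod (edge_ideal K H)).

(** The iterated quotient of [E] by the edge ideal and then by [s] is the quotient
    by a single ideal. *)
Lemma mem_ideal_mul s x : {subset s <= E1} ->
  (\pi_M (x : E^o) \in ideal_mul (ideal_span (fun l => l \in s)) M) =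
  (x \in add_rideals edge_idealv s).
Proof.
move=> sE; set W := add_rideals _ _.
have hW : left_closed W by apply: add_rideals_left_closed edge_idealv_left_closed.
have IW z : (z : E^o) \in edge_ideal K H -> z \in W.
  by rewrite mem_edge_ideal; apply/subvP/sub_add_rideals.
have reprW z : ((repr (\pi_M (z : E^o)) : E) \in W) = (z \in W).
  rewrite -[X in X \in W](subrK z) rpredDl //; apply: IW.
  by rewrite Quotient.idealrBE reprK.
apply/idP/idP.
  have NW : submod_closed (fun m : M => (repr m : E) \in W).
    split=> [|a m m' mW m'W].
      by rewrite -(raddf0 \pi_M) [_ \in _]reprW mem0v.
    rewrite -topredE /=.
    rewrite -[m]reprK -[m']reprK pi_scale -raddfD [_ \in W]reprW memvD // hW //.
  move=> /asboolP/(_ (Submodule NW)) h; rewrite -reprW; apply: h.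
  move=> _ [a [y [aS ->]]]; rewrite -[y]reprK pi_scale -topredE /= [_ \in W]reprW.
  have CW : submod_closed (fun a : E^o => `[< forall z, (a : E) * z \in W >]).
    split=> [|b c c' /asboolP hc /asboolP hc']; apply/asboolP => z.
      by rewrite mul0r mem0v.
    by rewrite mulrDl memvD // /GRing.scale /= -mulrA hW.
  have : a \in Submodule CW.
    apply: ideal_span_min aS => l z ls; apply/asboolP => z'.
    by rewrite -mulrA add_rideals_mem.
  by rewrite -topredE => /= /asboolP; apply.
elim/add_rideals_ind: x / => [x y hx hy|x xI|l z ls].
- by rewrite raddfD rpredD.
- suff -> : \pi_M (x : E^o) = 0 by exact: rpred0.
  by apply/eqP; rewrite pi_eq0 mem_edge_ideal.
apply/asboolP => N; apply; exists l, (\pi_M (z : E^o)); rewrite pi_scale; split=> //.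
by rewrite -[l]mulr1; apply: ideal_span_mem.
Qed.

Lemma regularE s l : {subset s <= E1} -> l \in E1 ->
  regular (quotmod (ideal_mul (ideal_span (fun l => l \in s)) M)) l <->
  regular_mod (add_rideals edge_idealv s) l.
Proof.
move=> sE lE; set W := add_rideals _ _; set N := ideal_mul _ _.
have hW : left_closed W by apply: add_rideals_left_closed edge_idealv_left_closed.
pose q (x : E) : quotmod N := \pi_(quotmod N) (\pi_M (x : E^o)).
have qM a x : a *: q x = q (a * x) by rewrite /q !pi_scale.
have q0 x : (q x == 0) = (x \in W) by rewrite /q pi_eq0 mem_ideal_mul.
have qB x y : q x - q y = q (x - y) by rewrite /q !raddfB.
have qK (y : quotmod N) : q (repr (repr y)) = y by rewrite /q !reprK.
split=> [reg x /[!(=^~ q0, =^~ qM)] /eqP/reg[z ez]|reg y].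
  apply/memv_addP; exists (x - l * repr (repr z)).
    by rewrite -q0 -qB -qM qK -ez subrr.
  exists (l * repr (repr z)); last by rewrite subrK.
  by apply/ridealP; exists (repr (repr z)).
split=> [|[z ->]].
  rewrite -{1}[y]qK qM => /eqP; rewrite q0 => /reg/memv_addP[w wW].
  case=> _ /ridealP[z ->] yE.
  by exists (q z); apply/eqP; rewrite -[y]qK yE qM -subr_eq0 qB addrK q0.
by apply/eqP; rewrite -[z]qK !qM q0 mulrA ext1_sqr // mul0r mem0v.
Qed.

Lemma regular_seqE s : {subset s <= E1} ->
  regular_seq M s <->
  (2 ^ size s * codim (add_rideals edge_idealv s) <= codim edge_idealv)%N.
Proof.
move=> sE; have [_ ->] := codim_regular_seq sE edge_idealv_left_closed.
have iE i : (i < size s)%N -> {subset take i s <= E1} /\ s`_i \in E1.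
  by move=> hi; split=> [x /mem_take|]; [apply: sE | apply/sE/mem_nth].
split=> [[_ reg] i hi|reg]; first by have [? ?] := iE i hi; apply/regularE/reg.
by split=> // i hi; have [? ?] := iE i hi; apply/regularE/reg.
Qed.

(** A combination [l] can replace the element [s_i] of [s] that has a nonzero
    coefficient: the new sequence generates an ideal containing the old one, so
    it satisfies the dimension criterion as well, and its first element [l] is
    then regular. *)
Lemma regular_seq_comb s (c : 'I_(size s) -> K) i : regular_seq M s -> c i != 0 ->
  regular_mod edge_idealv (\sum_j c j *: s`_j).
Proof.
move=> regs ci; set l := \sum_j _; pose t := take i s ++ drop i.+1 s.
have sE : {subset s <= E1} by case: regs.
have lE : l \in E1 by apply: rpred_sum => j _; apply/rpredZ/sE/mem_nth.
have tE : {subset l :: t <= E1}.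
  move=> x; rewrite inE mem_cat => /or3P[/eqP->//|/mem_take|/mem_drop]; exact: sE.
have st : size (l :: t) = size s.
  by rewrite /= size_cat size_takel 1?ltnW // size_drop -addnS subnSK // subnKC // ltnW.
have jt (j : 'I_(size s)) : j != i -> s`_j \in t.
  rewrite -val_eqE neq_ltn mem_cat /= => /orP[ji|ij].
    by rewrite -(nth_take 0 ji) mem_nth // size_take ltn_ord.
  apply/orP; right; rewrite -(subnKC ij) -nth_drop mem_nth // size_drop.
  by rewrite ltn_sub2r //; apply: leq_ltn_trans ij _.
have sub : (add_rideals edge_idealv s <= add_rideals edge_idealv (l :: t))%VS.
  apply/add_rideals_sub; split=> [|x xs]; first exact: sub_add_rideals.
  apply/subvP => _ /ridealP[z ->].
  have [xt|nxt] := boolP (x \in t); first by rewrite add_rideals_mem // inE xt orbT.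
  have -> : x = (c i)^-1 *: (l - \sum_(j | j != i) c j *: s`_j).
    rewrite /l (bigD1 i) //= addrK scalerA mulVf // scale1r.
    have [j js ex] := nthP 0 xs; rewrite -ex in nxt *.
    apply/eqP; apply: contraNT nxt => ne.
    by rewrite (jt (Ordinal js)) //; apply: contraNneq ne => <-.
  rewrite -scalerAl memvZ // mulrBl.
  rewrite memvB ?(add_rideals_mem _ _ (mem_head l t)) // mulr_suml.
  apply: rpred_sum => j ji; rewrite -scalerAl memvZ // add_rideals_mem //.
  by rewrite inE jt ?orbT.
have [_ reg] := codim_regular_seq tE edge_idealv_left_closed.
apply: (reg.1 _ 0 isT).
rewrite st.
apply: leq_trans ((regular_seqE sE).1 regs).
by rewrite leq_mul2l /codim leq_sub2l ?orbT // dimvS.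
Qed.

(** The element [e_F] witnesses that [l] is not regular. It is annihilated by [l]
    modulo the edge ideal because [F] is a dominating set. To see that it is not
    in [I + (l)], specialize each variable [e_v] to [g_v e_(c v)], which is [e_v]
    itself for [v] in [F]: the hypotheses say that this kills [l] and the
    edges. In terms of the exterior algebra, specializing is multiplying by the
    product [w] of the forms [e_v - g_v e_(c v)] for [v] outside [F], which
    satisfies [w e_v = g_v w e_(c v)]; and [w e_F] is, up to sign, the product of
    all variables, as [c v] lies in [F]. *)
Lemma edge_obstruction l (F : {set H}) (g : H -> K) (c : H -> H) :
    l \in E1 ->
    (forall v, v \notin F -> exists2 u, u \in F & edge u v) ->
    (forall v, v \in F -> g v = 1 /\ c v = v) ->
    (forall v, g v != 0 -> c v \in F) ->
    (forall u v, edge u v -> g u != 0 -> g v != 0 -> c u = c v) ->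
    \sum_v (l [set v] * g v) *: e (c v) = 0 ->
  ~ regular_mod edge_idealv l.
Proof.
move=> lE dom gF cF gc l0 reg; pose p v := e v - g v *: e (c v).
pose w := \prod_(v <- enum (~: F)) p v.
have pE v : p v \in E1 by rewrite memvB ?memvZ ?ext_var_in.
have wp v : w * p v = 0.
  have [vF|nvF] := boolP (v \in F); last first.
    by apply: linear_form_prod_kill; rewrite // mem_enum inE.
  by have [gv cv] := gF v vF; rewrite /p gv cv scale1r subrr mulr0.
have we v : w * e v = g v *: (w * e (c v)).
  by rewrite -[e v](subrK (g v *: e (c v))) mulrDr wp add0r scalerAr.
have wl : w * l = 0.
  transitivity (w * \sum_v (l [set v] * g v) *: e (c v)); last by rewrite l0 mulr0.
  rewrite {1}(ext1_sum lE) !mulr_sumr.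
  by apply: eq_bigr => v _; rewrite -!scalerAr we scalerA.
have wI x : x \in edge_idealv -> w * x = 0.
  elim/edge_idealv_ind: x / => [|x y wx wy|u v x uv]; first exact: mulr0.
    by rewrite mulrDr wx wy addr0.
  rewrite !mulrA we -!scalerAl -(mulrA w) ext_var_anti mulrN mulrA we.
  have [->|gu] := eqVneq (g u) 0; first by rewrite scale0r.
  have [->|gv] := eqVneq (g v) 0; first by rewrite scale0r mul0r oppr0 mul0r scaler0.
  by rewrite (gc u v) // -scalerAl -mulrA ext_var_sqr mulr0 scaler0 oppr0 mul0r scaler0.
have wF r : uniq r -> {in r, forall v, v \notin F} ->
    exists k : nat, (\prod_(v <- r) p v) * ext_mono K F =
      (-1) ^+ k *: ext_mono K ([set:: r] :|: F).
  elim: r => [|v r IH] /=.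
    by exists 0%N; rewrite big_nil mul1r scale1r set_nil set0U.
  move=> /andP[vr ur] rF; have [x xr|k ek] := IH ur.
    by apply: rF; rewrite inE xr orbT.
  exists (k + inversions [set v] ([set:: r] :|: F))%N.
  rewrite big_cons -mulrA ek -scalerAr /p mulrBl ext_var_mono; last first.
    by rewrite !inE negb_or vr rF ?inE ?eqxx.
  rewrite -scalerAl; have -> : g v *: (e (c v) * ext_mono K ([set:: r] :|: F)) = 0.
    have [->|/cF cvF] := eqVneq (g v) 0; first by rewrite scale0r.
    by rewrite ext_var_mono0 ?scaler0 // inE cvF orbT.
  by rewrite subr0 scalerA exprD set_cons setUA.
have [k wFk] : exists k : nat, w * ext_mono K F = (-1) ^+ k *: ext_mono K setT.
  have [|v|k ek] := wF (enum (~: F)); first exact: enum_uniq.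
    by rewrite mem_enum inE.
  by exists k; rewrite ek set_enum setUC setUCr.
have lF : l * ext_mono K F \in edge_idealv.
  rewrite (ext1_sum lE) mulr_suml rpred_sum // => v _; rewrite -scalerAl rpredZ //.
  have [vF|/dom[u uF uv]] := boolP (v \in F); first by rewrite ext_var_mono0 ?mem0v.
  by rewrite (ext_mono_var K uF) -scalerAr memvZ // mulrA edge_idealv_mem // edge_sym.
have /memv_addP[x xI [_ /ridealP[z ->] eF]] := reg _ lF.
have : w * ext_mono K F = 0 by rewrite eF mulrDr wI // mulrA wl mul0r addr0.
rewrite wFk => /eqP; rewrite scaler_eq0 signr_eq0 /= => /eqP/ffunP/(_ setT)/eqP.
by rewrite !ffunE eqxx oner_eq0.
Qed.


Definition indep (A : {set H}) := [forall u in A, forall v in A, ~~ edge u v].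

Lemma indepP (A : {set H}) :
  reflect (forall u v, u \in A -> v \in A -> ~~ edge u v) (indep A).
Proof.
apply: (iffP forall_inP) => [h u v /h/forall_inP|h u uA]; first exact.
by apply/forall_inP => v; apply: h.
Qed.

Lemma mono_dependent (A : {set H}) u v :
  u \in A -> v \in A -> edge u v -> ext_mono K A \in edge_idealv.
Proof.
move=> uA vA uv; have vAu : v \in A :\ u.
  by rewrite !inE vA andbT; apply: contraTneq uv => ->; rewrite edge_irr.
rewrite (ext_mono_var K uA) (ext_mono_var K vAu) -scalerAr !memvZ // mulrA.
exact: edge_idealv_mem.
Qed.

(** The edge ideal is spanned by monomials of dependent sets: its elements have
    zero coefficients on the independent ones. *)
Lemma card_indep_codim : (#|[set A | indep A]| <= codim edge_idealv)%N.
Proof.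
pose D := [seq ext_mono K A | A in [pred A : {set H} | ~~ indep A]].
have coef0 x : x \in edge_idealv -> forall A, indep A -> x A = 0.
  elim/edge_idealv_ind: x / => [|x y hx hy|u v x uv] A iA; first by rewrite ffunE.
    by rewrite ffunE hx // hy // addr0.
  rewrite -mulrA !ext_var_mulE; case: ifP => // uA; case: ifP; rewrite ?mulr0 //.
  by rewrite !inE => /andP[_ vA]; have /indepP/(_ u v uA vA)/negP := iA.
have sub : (edge_idealv <= <<D>>)%VS.
  apply/subvP => x xI; rewrite (ext_mono_sum x) rpred_sum // => A _.
  have [/(coef0 _ xI)->|nA] := boolP (indep A); first by rewrite scale0r mem0v.
  by rewrite rpredZ // memv_span //; apply/imageP; exists A.
have := leq_trans (dimvS sub) (dim_span D); rewrite size_image /codim => le.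
apply: leq_trans (leq_sub2l _ le).
have -> : dim E = #|{: {set H}}| by rewrite -[LHS]/(#|{: {set H}}| * 1)%N muln1.
by rewrite -(cardC indep) addnK cardsE.
Qed.

Lemma codim_le_card U (R : {set {set H}}) :
    (forall A, ext_mono K A \in (U + <<[seq ext_mono K B | B in R]>>)%VS) ->
  (codim U <= #|R|)%N.
Proof.
move=> hU; set D := [seq _ | B in R] in hU.
have sub : (fullv <= U + <<D>>)%VS.
  by apply/subvP => x _; rewrite (ext_mono_sum x) rpred_sum // => A _; rewrite rpredZ.
have := leq_trans (dimvS sub) (dimv_add_leqif U <<D>>).
have := dim_span D; rewrite size_image dimvf /codim leq_subLR => h h'.
by apply: leq_trans h' _; rewrite leq_add2l.
Qed.

End QuotientModules.

(** * The graph W(W(G, a), b) *)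

Section DoubleWhisker.
Variables (K : fieldType) (G : sgraph) (a b : nat).
Local Notation H := (whisker (whisker G a) b).
Local Notation E := (ext K H).
Local Notation e := (ext_var K (V := H)).
Local Notation M := (quotmod (edge_ideal K H)).

Definition core (x : G) : H := inl (inl x).
Definition core_leaf (x : G) (j : 'I_b) : H := inr (inl x, j).
Definition center (q : G * 'I_a) : H := inl (inr q).
Definition star_leaf (q : G * 'I_a) (j : 'I_b) : H := inr (inr q, j).

Lemma big_double_whisker (F : H -> E) : \sum_v F v =
  \sum_x F (core x) + \sum_q F (center q) +
  (\sum_(p : G * 'I_b) F (core_leaf p.1 p.2) + \sum_q \sum_j F (star_leaf q j)).
Proof.
rewrite big_sumType big_sumType /=; congr (_ + _).
rewrite (eq_bigr (fun p => F (inr (p.1, p.2)))); last by case.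
by rewrite -(pair_bigA _ (fun y j => F (inr (y, j)))) big_sumType pair_bigA.
Qed.

(** In a star whose center has coefficient [alpha] in [l], pick a leaf with
    coefficient [beta <> 0] if there is one. Then [F] contains the center, and
    that leaf is specialized to [- alpha / beta] times the center, the other
    leaves to 0, so that [l] vanishes on the star. If there is no such leaf, [F]
    contains the leaves and the center is specialized to 0. The core vertices
    are specialized to 0. *)
Lemma nonregular (l : E) : (0 < b)%N -> l \in ext1 K H ->
  (forall x j, l [set core_leaf x j] = 0) -> ~ regular_mod (edge_idealv K H) l.
Proof.
move=> b0 lE l0.
pose pk q := [pick j | l [set star_leaf q j] != 0].
pose F := [set v : H | match v with
  | inl (inl _) => false
  | inl (inr q) => isSome (pk q)
  | inr (inl _, _) => true
  | inr (inr q, j) => ~~ isSome (pk q) end].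
pose c (v : H) : H :=
  if v is inr (inr q, _) then if isSome (pk q) then center q else v else v.
pose g (v : H) : K := match v with
  | inl (inl _) => 0
  | inl (inr q) => (isSome (pk q))%:R
  | inr (inl _, _) => 1
  | inr (inr q, j) => if pk q is Some j0 then
      if j == j0 then - l [set center q] / l [set star_leaf q j0] else 0 else 1 end.
apply: (@edge_obstruction _ _ l F g c lE).
- case=> [[x|q]|[[x|q] j]]; rewrite inE // => h.
  + by exists (core_leaf x (Ordinal b0)); rewrite ?inE //= eqxx.
  + by exists (star_leaf q (Ordinal b0)); rewrite ?inE //= eqxx.
  + by exists (center q); rewrite ?inE //= ?eqxx //; case: (pk q) h.
- case=> [[x|q]|[[x|q] j]]; rewrite inE //= => h; rewrite ?h //.
  by case: (pk q) h.
- case=> [[x|q]|[[x|q] j]]; rewrite inE //= ?eqxx //.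
  + by case: (pk q); rewrite ?eqxx.
  + by case pkq: (pk q); rewrite /= pkq.
- case=> [[x|q]|[[x|q] j]]; case=> [[y|q']|[[y|q'] j']] //=; rewrite ?eqxx //.
  + by case: q.
  + by move=> /eqP[<-]; case: (pk q); rewrite ?eqxx.
  + by move=> /eqP[<-]; case: (pk q); rewrite ?eqxx.
rewrite big_double_whisker /= big1 => [|x _]; last by rewrite mulr0 scale0r.
rewrite add0r addrCA big1 => [|p _]; last by rewrite l0 mul0r scale0r.
rewrite add0r -big_split /= big1 // => q _.
case pkq: (pk q) => [j0|] /=.
  rewrite (bigD1 j0) //= big1 => [|j /negPf nj]; last first.
    by rewrite nj mulr0 scale0r.
  rewrite eqxx addr0 -scalerDl mulr1.
  have lj0 : l [set star_leaf q j0] != 0.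
    by move: pkq; rewrite /pk; case: pickP => // j hj [<-].
  by rewrite mulrCA mulfV // mulr1 addrN scale0r.
rewrite mulr0 scale0r add0r big1 // => j _.
have -> : l [set star_leaf q j] = 0; last by rewrite mul0r scale0r.
by move: pkq; rewrite /pk; case: pickP => // /(_ j)/negbFE/eqP.
Qed.

(** The combinations of [s] without core leaves are the solutions of [#|G| * b]
    linear equations in [size s] unknowns. *)
Lemma regular_seq_size s : (0 < b)%N -> regular_seq M s -> (size s <= #|G| * b)%N.
Proof.
move=> b0 regs; rewrite leqNgt; apply/negP => ltbs.
have sE : {subset s <= ext1 K H} by case: regs.
pose A : 'M[K]_(size s, #|{: G * 'I_b}|) :=
  \matrix_(i, k) s`_i [set core_leaf (enum_val k).1 (enum_val k).2].
have : kermx A != 0.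
  rewrite kermx_eq0 /row_free neq_ltn (leq_ltn_trans (rank_leq_col A)) //.
  by rewrite card_prod card_ord.
rewrite -nz_row_eq0 => /rV0Pn[i ci]; set c := nz_row _ in ci.
have /sub_kermxP cA : (c <= kermx A)%MS by apply: nz_row_sub.
apply: (@nonregular (\sum_j c 0 j *: s`_j) b0); last exact: regular_seq_comb regs ci.
  by apply: rpred_sum => j _; apply/rpredZ/sE/mem_nth.
move=> x j; have /rowP/(_ (enum_rank (x, j))) := cA.
rewrite !mxE => <-; rewrite sum_ffunE; apply: eq_bigr => k _.
by rewrite ffunE mxE enum_rankK.
Qed.

Section RegularSequence.

(* The star chosen at each core vertex. *)
Variable i0 : 'I_a.

Implicit Types (A B : {set H}) (p : G * 'I_b).

(** The leaf of the pair [p] that can be freely added to or removed from an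
    independent set [A]. The only neighbor of a star leaf is its center, which is
    excluded from [A] if the core vertex is in [A]; the only neighbor of a core
    leaf is the core vertex. *)
Definition toggle A p : H :=
  if core p.1 \in A then star_leaf (p.1, i0) p.2 else core_leaf p.1 p.2.

Definition leaf_pair p : E := e (core_leaf p.1 p.2) + e (star_leaf (p.1, i0) p.2).

Definition leaf_pairs : seq E := [seq leaf_pair p | p : G * 'I_b].

Definition reduced : {set {set H}} :=
  [set A | indep A && [forall p, toggle A p \notin A]].

Lemma leaf_pairs_ext1 : {subset leaf_pairs <= ext1 K H}.
Proof. by move=> _ /imageP[p _ ->]; rewrite memvD ?ext_var_in. Qed.

(** By induction on the number of core leaves in [A]. If [A] contains a toggle,
    replace it by the opposite of the other leaf of its pair; the monomial
    vanishes if that leaf is already in [A]. When the core vertex is present, the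
    result contains an edge; when it is absent, the result has one core leaf
    less. *)
Lemma leaf_pairs_span A : ext_mono K A \in
  (add_rideals (edge_idealv K H) leaf_pairs + <<[seq ext_mono K B | B in reduced]>>)%VS.
Proof.
set W := add_rideals _ _; set S := (W + _)%VS.
have WS : (W <= S)%VS := addvSl _ _.
have IS B u v : u \in B -> v \in B -> edge u v -> ext_mono K B \in S.
  move=> uB vB uv; apply/(subvP WS)/(subvP (sub_add_rideals _ _)).
  exact: mono_dependent uB vB uv.
pose leaves B := [set p | core_leaf p.1 p.2 \in B].
have [n] := ubnP #|leaves A|; elim: n A => // n IH A; rewrite ltnS => leA.
have [/indepP iA|] := boolP (indep A); last first.
  rewrite negb_forall => /existsP[u]; rewrite negb_imply negb_forall.
  move=> /andP[uA /existsP[v]]; rewrite negb_imply negbK => /andP[vA]; exact: IS.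
have [rA|] := boolP [forall p, toggle A p \notin A].
  apply: (subvP (addvSr _ _)); apply/memv_span/imageP; exists A => //.
  by rewrite inE rA andbT; apply/indepP.
rewrite negb_forall => /existsP[p]; rewrite negbK => tA.
have lS B : leaf_pair p * ext_mono K B \in S.
  by apply/(subvP WS)/add_rideals_mem/imageP; exists p.
rewrite (ext_mono_var K tA) memvZ //; move: tA; rewrite /toggle.
case: ifP => [cA|/negbT ncA] tA; set B := A :\ _.
  have -> : e (star_leaf (p.1, i0) p.2) = leaf_pair p - e (core_leaf p.1 p.2).
    by rewrite /leaf_pair addrAC subrr add0r.
  rewrite mulrBl memvB //.
  have [tB|ntB] := boolP (core_leaf p.1 p.2 \in B).
    by rewrite ext_var_mono0 ?mem0v.
  rewrite ext_var_mono // memvZ //.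
  by apply: (IS _ (core p.1) (core_leaf p.1 p.2)); rewrite ?inE ?eqxx ?cA //= eqxx.
have -> : e (core_leaf p.1 p.2) = leaf_pair p - e (star_leaf (p.1, i0) p.2).
  by rewrite /leaf_pair addrK.
rewrite mulrBl memvB //.
have [dB|ndB] := boolP (star_leaf (p.1, i0) p.2 \in B).
  by rewrite ext_var_mono0 ?mem0v.
rewrite ext_var_mono // memvZ // IH // (leq_trans _ leA) // proper_card //.
apply/properP; split; first by apply/subsetP => q; rewrite !inE => /andP[].
by exists p; rewrite !inE ?eqxx ?tA.
Qed.

Lemma toggle_inj A : injective (toggle A).
Proof.
move=> [x j] [y k]; rewrite /toggle /=.
by case: ifP => _; case: ifP => _ // [-> ->].
Qed.

Lemma toggle_not_core A p x : (toggle A p == core x) = false.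
Proof. by rewrite /toggle; case: ifP. Qed.

(** The neighbor of a toggle is a core vertex or a center, hence no toggle; it is
    not in [A] by the choice of the leaf in [toggle]. *)
Lemma toggle_edge A p v : indep A -> edge (toggle A p) v ->
  v \notin A /\ forall q, v != toggle A q.
Proof.
move=> /indepP iA; rewrite /toggle; case: ifP => [cA|/negbT ncA].
  case: v => [v|v] //= /eqP <-; split; last by move=> r; case: ifP.
  by apply/negP => qA; have /negP := iA _ _ cA qA; rewrite /= eqxx.
by case: v => [v|v] //= /eqP <-; split=> // q; case: ifP.
Qed.

(** Adding to a reduced set the toggles of an arbitrary set of pairs gives an
    independent set. Both can be recovered from the result, because toggles do
    not depend on the leaves and so are the same for the result as for the
    reduced set. *)
Lemma card_reduced_indep : (2 ^ (#|G| * b) * #|reduced| <= #|[set A | @indep H A]|)%N.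
Proof.
pose f (q : {set G * 'I_b} * {set H}) := q.2 :|: toggle q.2 @: q.1.
have fcore q x : (core x \in f q) = (core x \in q.2).
  rewrite inE orbC; case: imsetP => // -[p _ /eqP]; by rewrite eq_sym toggle_not_core.
have ftog q p : toggle (f q) p = toggle q.2 p by rewrite /toggle fcore.
have red A p : A \in reduced -> toggle A p \notin A.
  by rewrite inE => /andP[_ /forallP].
have fB q p : q.2 \in reduced -> (toggle (f q) p \in f q) = (p \in q.1).
  by move=> qR; rewrite ftog inE (negPf (red _ _ qR)) mem_imset //; apply: toggle_inj.
have fA q : q.2 \in reduced -> f q :\: [set toggle (f q) p | p : G * 'I_b] = q.2.
  move=> qR; rewrite (eq_imset _ (ftog q)); apply/setP => v; rewrite !inE orbC.
  case: imsetP => [[p _ ->]|nv] /=; first by rewrite (negPf (red _ _ qR)).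
  by case: imsetP => // -[p _ ev]; case: nv; exists p.
have finj : {in [set q | q.2 \in reduced] &, injective f}.
  move=> q q' /[1!inE] qR /[1!inE] q'R eqf.
  have eA : q.2 = q'.2 by rewrite -[LHS]fA // -[RHS]fA // eqf.
  have eB : q.1 = q'.1.
    by apply/setP => p; rewrite -[LHS]fB // -[RHS]fB // eqf.
  by rewrite [q]surjective_pairing eA eB -surjective_pairing.
have cardT : #|{set G * 'I_b}| = (2 ^ (#|G| * b))%N.
  have := card_powerset [set: G * 'I_b].
  by rewrite powersetT !cardsT card_prod card_ord.
rewrite -cardT -cardsT -cardsX.
rewrite (_ : setX _ _ = [set q | q.2 \in reduced]); last first.
  by apply/setP => -[B A]; rewrite !inE.
rewrite -(card_in_imset finj) subset_leq_card //.
apply/subsetP => _ /imsetP[q qR ->]; rewrite !inE /= in qR *.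
have [/indepP iA _] := andP qR; apply/indepP => u v.
have tE p w : w \in f q -> edge (toggle q.2 p) w -> False.
  rewrite inE => wf /toggle_edge[|nw ntw]; first exact/indepP.
  by case/orP: wf => [/(negP nw)//|/imsetP[r _ ew]]; move: (ntw r); rewrite ew eqxx.
move=> uf vf; apply/negP => uv.
move: (uf) (vf); rewrite !inE => /orP[uA|/imsetP[p _ eu]] /orP[vA|/imsetP[r _ ev]].
- by have /negP := iA _ _ uA vA.
- by apply: (tE r u uf); rewrite -ev edge_sym.
- by apply: (tE p v vf); rewrite -eu.
- by apply: (tE p v vf); rewrite -eu.
Qed.

Lemma leaf_pairs_regular : regular_seq M leaf_pairs.
Proof.
apply/regular_seqE; first exact: leaf_pairs_ext1.
apply: leq_trans (card_indep_codim K H).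
apply: leq_trans card_reduced_indep.
rewrite size_image card_prod card_ord leq_mul2l; apply/orP; right.
exact/codim_le_card/leaf_pairs_span.
Qed.
End RegularSequence.

End DoubleWhisker.

Local Close Scope quotient_scope.
Local Close Scope ring_scope.

Lemma depth_whisker_whisker (K : fieldType) (G : sgraph) (a b : nat) :
  0 < a -> 0 < b -> graph_has_depth K (whisker (whisker G a) b) (#|G| * b).
Proof.
move=> a0 b0; split; last by move=> s; apply: regular_seq_size.
exists (leaf_pairs K G b (Ordinal a0)); first exact: leaf_pairs_regular.
by rewrite size_image card_prod card_ord.
Qed.

Lemma card_whiskers (G : sgraph) (m : nat -> nat) k :
  #|whiskers G m k| = #|G| * \prod_(1 <= i < k.+1) (m i + 1).
Proof.
elim: k => [|k IH] /=; first by rewrite big_nil muln1.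
rewrite card_sum card_prod card_ord IH [in RHS]big_nat_recr //= mulnA.
by rewrite mulnDr muln1 addnC.
Qed.

Theorem corollary3p18 (K : closedFieldType) (charK : [pchar K]%R =i pred0)
    (G : sgraph) :
  (forall (k : nat) (m : nat -> nat),
      2 <= k -> (forall i, 1 <= i <= k -> 0 < m i) ->
      graph_has_depth K (whiskers G m k)
        (#|G| * (\prod_(1 <= i < k.-1) (m i + 1)) * m k)) /\
  (forall k m : nat, 0 < m -> 2 <= k ->
      graph_has_depth K (whisker_iter G m k)
        (#|G| * m * (m + 1) ^ (k - 2))).
Proof.
have depth_whiskers (k : nat) (m : nat -> nat) : 2 <= k ->
    (forall i, 1 <= i <= k -> 0 < m i) ->
    graph_has_depth K (whiskers G m k)
      (#|G| * (\prod_(1 <= i < k.-1) (m i + 1)) * m k).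
  case: k => [|[|k]] // _ m0; rewrite /= -card_whiskers.
  by apply: depth_whisker_whisker; apply: m0; rewrite !ltnS ?leqnn ?leqnSn.
split=> // k m m0 k2; have := depth_whiskers k (fun=> m) k2 (fun _ _ => m0).
rewrite prod_nat_const_nat mulnAC.
by case: k k2 => [|[|k]] // _; rewrite /= subSS.
Qed.
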